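(* Let $\mathcal Y$ be finite-dimensional. Let $p\in[1,\infty]$ and suppose $c_0(\mathcal Z)\cap B^p(\mathcal Z)\subseteq\underline{\mathcal Z}\subseteq\ell^p(\mathcal Z)$. Let $H:\underline{\mathcal Z}\to\mathcal Y$ be a linear functional. (i) If $p=1$: $H$ has the $1$-weighted FMP if and only if it has a (proper) convolution representation $\underline\kappa$ with $\lim_{t\to-\infty}\|\kappa_t\|_{op}=0$. Furthermore, the following are equivalent: $H$ is $1$-continuous; $H$ has a (proper) convolution representation with $\|\underline\kappa\|_\infty<\infty$; $H$ has the minimal FMP and is minimally continuous. (ii) If $p\in(1,\infty)$ and $q\in(1,\infty)$ is its Hölder conjugate ($1/p+1/q=1$), the following are equivalent: $H$ has the $p$-weighted FMP; $H$ is $p$-continuous; $H$ has a (proper) convolution representation with $\|\underline\kappa\|_q<\infty$; $H$ has the minimal FMP and is minimally continuous. (iii) If $p=\infty$, the following are equivalent: $H$ has the $\infty$-weighted FMP; $H$ has a (proper) convolution representation with $\|\underline\kappa\|_1<\infty$; $H$ has the minimal FMP and is minimally continuous. Furthermore, if in addition $\underline{\mathcal Z}\subseteq c_0(\mathcal Z)$, then $H$ has the $\infty$-weighted FMP if and only if it is $\infty$-continuous.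
   Context: Let $(\mathcal Z,\|\cdot\|)$ and $(\mathcal Y,\|\cdot\|_{\mathcal Y})$ be normed vector spaces over $\mathbb R$ and $\mathcal B=\{z\in\mathcal Z:\|z\|\le1\}$. Let $\mathbb Z_-=\{0,-1,-2,\dots\}$; elements of $\mathcal Z^{\mathbb Z_-}$ are sequences $\underline z=(z_t)_{t\le0}$. For $t\in\mathbb Z_-$, $\delta^t:\mathcal Z\to\mathcal Z^{\mathbb Z_-}$ maps $z$ to the sequence whose entry at time $t$ is $z$ and all other entries are $0$. Standing assumption: $\underline{\mathcal Z}\subseteq\mathcal Z^{\mathbb Z_-}$ is a set such that (a) $\underline{\mathcal Z}$ is convex and $\underline{\mathcal Z}=\{-\underline z:\underline z\in\underline{\mathcal Z}\}$; (b) $\delta^t(\mathcal B)\subseteq\underline{\mathcal Z}$ for all $t\in\mathbb Z_-$; (c) for every $\underline z\in\underline{\mathcal Z}$ and every $J\subseteq\mathbb Z_-$, the sequence $\sum_{t\in J}\delta^t(z_t)$ (equal to $z_t$ at times $t\in J$ and $0$ elsewhere) belongs to $\underline{\mathcal Z}$. A functional $H:\underline{\mathcal Z}\to\mathcal Y$ is linear if it is the restriction of a linear map defined on the linear span of $\underline{\mathcal Z}$. $L(\mathcal Z,\mathcal Y)$ is the space of continuous linear maps $\mathcal Z\to\mathcal Y$ with operator norm $\|\cdot\|_{op}$; for $\underline\kappa\in L(\mathcal Z,\mathcal Y)^{\mathbb Z_-}$ and $q\in[1,\infty)$, $\|\underline\kappa\|_q=(\sum_{t\le0}\|\kappa_t\|_{op}^q)^{1/q}$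 and $\|\underline\kappa\|_\infty=\sup_{t\le0}\|\kappa_t\|_{op}$. $H$ has a formal convolution representation if there is $\underline\kappa\in L(\mathcal Z,\mathcal Y)^{\mathbb Z_-}$ with $H(\underline z)=\lim_{T\to-\infty}\sum_{t=T}^0\kappa_t(z_t)$ for all $\underline z\in\underline{\mathcal Z}$; it has a (proper) convolution representation if in addition $\sum_{t\le0}\|\kappa_t(z_t)\|_{\mathcal Y}<\infty$ for all $\underline z\in\underline{\mathcal Z}$. $H$ is minimally continuous if $H\circ\delta^t:\mathcal B\to\mathcal Y$ is continuous for every $t\in\mathbb Z_-$. $H$ has the minimal fading memory property (minimal FMP) if $H(\sum_{t=T}^0\delta^t(z_t))\to H(\underline z)$ as $T\to-\infty$ for every $\underline z\in\underline{\mathcal Z}$. For $p\in[1,\infty]$, $\ell^p(\mathcal Z)$ is the set of $\underline z$ with $\|\underline z\|_p=(\sum_{t\le0}\|z_t\|^p)^{1/p}<\infty$ (for $p=\infty$: $\|\underline z\|_\infty=\sup_{t\le0}\|z_t\|<\infty$); $B^p(\mathcal Z)=\{\underline z\in\ell^p(\mathcal Z):\|\underline z\|_p\le1\}$; $c_0(\mathcal Z)$ is the set of sequences with $\|z_t\|\to0$ as $t\to-\infty$. A weighting sequence is a monotone $\underline w\in(0,1]^{\mathbb Z_-}$ with $w_t\to0$ as $t\to-\infty$; set $\|\underline z\|_{p,\underline w}=(\sum_{t\le0}w_t\|z_t\|^p)^{1/p}$ for $p<\infty$ and $\|\underline z\|_{\infty,\underline w}=\sup_{t\le0}w_t\|z_t\|$.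 $H$ is $p$-continuous if $\underline{\mathcal Z}\subseteq\ell^p(\mathcal Z)$ and $H$ is continuous for the topology induced by $\|\cdot\|_p$. $H$ has the $p$-weighted FMP if $\underline{\mathcal Z}\subseteq\ell^p(\mathcal Z)$ and there is a weighting sequence $\underline w$ such that $H$ is continuous for the topology induced by $\|\cdot\|_{p,\underline w}$. *)

(* Defs.v *)
From HB Require Import structures.
From mathcomp Require Import all_boot all_order all_algebra.
From mathcomp Require Import all_classical all_reals all_analysis.
Set Implicit Arguments. Unset Strict Implicit. Unset Printing Implicit Defensive.
Import Order.TTheory GRing.Theory Num.Theory.
Import numFieldNormedType.Exports.
Local Open Scope classical_set_scope.
Local Open Scope ring_scope.

(* Convention: the time index t in Z_- = {0,-1,-2,...} is encoded by the
   natural number n = -t.  A sequence (z_t)_{t<=0} is a function nat -> Z,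
   and "t -> -oo" is "n -> +oo". *)

Section Defs.
Variable R : realType.

Definition delta (Z : normedModType R) (t : nat) (z : Z) : nat -> Z :=
  fun n => if n == t then z else 0.

Definition trunc (Z : normedModType R) (N : nat) (z : nat -> Z) : nat -> Z :=
  fun n => if (n <= N)%N then z n else 0.

Definition standing (Z : normedModType R) (S : set (nat -> Z)) : Prop :=
  [/\ (forall x y, S x -> S y -> forall l : R, 0 <= l <= 1 ->
          S (fun t => l *: x t + (1 - l) *: y t)),
      (forall x, S x <-> S (fun t => - x t)),
      (forall (t : nat) (z : Z), `|z| <= 1 -> S (delta t z)) &
      (forall z, S z -> forall J : set nat,
          S (fun t => if `[< J t >] then z t else 0))].

Definition lspan (Z : normedModType R) (S : set (nat -> Z)) : set (nat -> Z) :=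
  [set x | exists n (c : 'I_n -> R) (s : 'I_n -> nat -> Z),
     (forall i, S (s i)) /\ x = (fun t => \sum_(i < n) c i *: s i t)].

Definition linear_on (Z Y : normedModType R) (S : set (nat -> Z))
  (H : (nat -> Z) -> Y) : Prop :=
  exists L : (nat -> Z) -> Y,
    (forall (a : R) u v, lspan S u -> lspan S v ->
        L (fun t => a *: u t + v t) = a *: L u + L v) /\
    (forall z, S z -> H z = L z).

Definition findim (Y : normedModType R) : Prop :=
  exists n (e : 'I_n -> Y), forall y : Y,
    exists c : 'I_n -> R, y = \sum_(i < n) c i *: e i.

Definition opnorm (Z Y : normedModType R) (f : Z -> Y) : R :=
  sup [set `|f z| | z in [set z : Z | `|z| <= 1]].

Definition seqnorm (p : \bar R) (w : nat -> R) (a : nat -> R) : \bar R :=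
  match p with
  | r%:E => ((\sum_(0 <= t <oo) (w t * a t `^ r)%:E) `^ r^-1)%E
  | +oo%E => ereal_sup [set (w t * a t)%:E | t in [set: nat]]
  | -oo%E => 0%E
  end.

Definition wnorm (Z : normedModType R) (p : \bar R) (w : nat -> R)
  (z : nat -> Z) : \bar R := seqnorm p w (fun t => `|z t|).
Definition pnorm (Z : normedModType R) (p : \bar R) (z : nat -> Z) : \bar R :=
  wnorm p (fun _ => 1) z.

Definition kappanorm (Z Y : normedModType R) (q : \bar R)
  (k : nat -> {linear Z -> Y}) : \bar R :=
  seqnorm q (fun _ => 1) (fun t => opnorm (k t)).

Definition lp (Z : normedModType R) (p : \bar R) : set (nat -> Z) :=
  [set z | (pnorm p z < +oo)%E].
Definition Bp (Z : normedModType R) (p : \bar R) : set (nat -> Z) :=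
  [set z | (pnorm p z <= 1)%E].
Definition c0 (Z : normedModType R) : set (nat -> Z) :=
  [set z | (fun t => `|z t|) @ \oo --> (0 : R)].

(* weighting sequence: monotone (in time t, i.e. nonincreasing in n = -t),
   values in (0,1], tending to 0 as t -> -oo *)
Definition weighting (w : nat -> R) : Prop :=
  [/\ (forall m n, (m <= n)%N -> w n <= w m),
      (forall t, 0 < w t <= 1) &
      w @ \oo --> (0 : R)].

Definition cont_wrt (Z Y : normedModType R) (N : (nat -> Z) -> \bar R)
  (S : set (nat -> Z)) (H : (nat -> Z) -> Y) : Prop :=
  forall z, S z -> forall e : R, 0 < e -> exists2 d : R, 0 < d &
    forall x, S x -> (N (fun t => (x t - z t)%R) < d%:E)%E -> `|H x - H z| < e.

Definition p_continuous (Z Y : normedModType R) (p : \bar R)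
  (S : set (nat -> Z)) (H : (nat -> Z) -> Y) : Prop :=
  S `<=` lp p /\ cont_wrt (pnorm p) S H.

Definition p_weighted_FMP (Z Y : normedModType R) (p : \bar R)
  (S : set (nat -> Z)) (H : (nat -> Z) -> Y) : Prop :=
  S `<=` lp p /\ exists w, weighting w /\ cont_wrt (wnorm p w) S H.

Definition minimally_continuous (Z Y : normedModType R)
  (H : (nat -> Z) -> Y) : Prop :=
  forall t : nat, {within [set z : Z | `|z| <= 1], continuous (fun z => H (delta t z))}.

Definition minimal_FMP (Z Y : normedModType R) (S : set (nat -> Z))
  (H : (nat -> Z) -> Y) : Prop :=
  forall z, S z -> (fun N => H (trunc N z)) @ \oo --> H z.

Definition formal_conv_rep (Z Y : normedModType R) (S : set (nat -> Z))
  (H : (nat -> Z) -> Y) (k : nat -> {linear Z -> Y}) : Prop :=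
  (forall t, continuous (k t)) /\
  forall z, S z -> (fun N => \sum_(0 <= t < N.+1) k t (z t)) @ \oo --> H z.

Definition conv_rep (Z Y : normedModType R) (S : set (nat -> Z))
  (H : (nat -> Z) -> Y) (k : nat -> {linear Z -> Y}) : Prop :=
  formal_conv_rep S H k /\
  forall z, S z -> (\sum_(0 <= t <oo) (`|k t (z t)|)%:E < +oo)%E.

End Defs.
Arguments c0 {R} Z.

(* Main.v *)
Require Import Defs.
From HB Require Import structures.
From mathcomp Require Import all_boot all_order all_algebra.
From mathcomp Require Import all_classical all_reals all_analysis.
From mathcomp Require Import ring lra.
Import Order.TTheory GRing.Theory Num.Theory.
Import numFieldNormedType.Exports.
Local Open Scope classical_set_scope.
Local Open Scope ring_scope.
Set Implicit Arguments. Unset Strict Implicit. Unset Printing Implicit Defensive.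

(* A linear H is determined on truncated sequences by kappa_t = H o delta^t, so
   minimal continuity and the minimal FMP amount to a formal convolution
   representation.  Convergence along every subset of times forces absolute
   convergence because Y is finite-dimensional.  Choosing nearly norming vectors
   for the kappa_t reduces summability of kappa to a scalar duality: if
   sum a_t b_t < oo for all a in c_0 and the unit ball of l^p, then b is in l^q.
   Conversely, weights come from the fact that a convergent series sum c_t
   admits v_t -> 0 with sum c_t / v_t < oo, combined with Young's inequality. *)

(** * Real sequences and duality *)

(** [S] is only convex and symmetric, so x - z may leave [S] for x, z in [S]. Continuity is
    therefore proved by bounding the sums of ‖kappa_t‖ |x_t - z_t|, which make sense in either case.
    Z is not assumed complete, so a uniform boundedness principle over Z is out of reach; passing to
    the scalars ‖kappa_t‖ makes it elementary, since real test sequences can be superposed by hand.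

    The chains of equivalences close through the pair of minimal FMP and minimal continuity, which
    follows from continuity in any norm in which truncations of z converge to z. Every l^p norm with
    p finite is of this kind. The sup norm requires a weight vanishing at infinity or z in c_0,
    which is why infinity-continuity enters (iii) only for [S] inside c_0. For p = 1 a bounded
    kernel has no summability to spend on a weight, and continuity in a weighted norm forces kappa_t
    -> 0, because delta^t maps the unit ball into a set of weighted size w_t. *)

Section RealSequences.
Context {R : realType}.
Implicit Types (u w a b c z : nat -> R) (M r q : R).

Lemma nneseries_leP u M : (forall t, 0 <= u t) ->
  (\sum_(0 <= t <oo) (u t)%:E <= M%:E)%E <->
  forall n, \sum_(0 <= t < n) u t <= M.
Proof.
move=> u0; split=> [h n|h].
  rewrite -lee_fin -sumEFin; apply: le_trans h.
  by apply: nneseries_lim_ge => t _ _; rewrite lee_fin.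
apply: lime_le; first by apply: is_cvg_nneseries => t _ _; rewrite lee_fin.
by apply: nearW => n; rewrite sumEFin lee_fin.
Qed.

Lemma nneseries_ltyP u : (forall t, 0 <= u t) ->
  (\sum_(0 <= t <oo) (u t)%:E < +oo)%E <->
  exists M, forall n, \sum_(0 <= t < n) u t <= M.
Proof.
move=> u0; split=> [h|[M h]]; last first.
  by apply: (@le_lt_trans _ _ M%:E); [exact/nneseries_leP|exact: ltry].
have s0 : (0 <= \sum_(0 <= t <oo) (u t)%:E)%E.
  by apply: nneseries_ge0 => t _ _; rewrite lee_fin.
exists (fine (\sum_(0 <= t <oo) (u t)%:E)%E).
by apply/nneseries_leP => //; rewrite fineK// ge0_fin_numE.
Qed.

(** Removes both the root and the extended reals, so that later estimates concern finite real sums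
    only. *)
Lemma seqnorm_leP r w a M : 0 < r -> 0 <= M -> (forall t, 0 <= w t) ->
  (seqnorm r%:E w a <= M%:E)%E <->
  forall n, \sum_(0 <= t < n) w t * a t `^ r <= M `^ r.
Proof.
move=> r0 M0 w0.
have u0 t : 0 <= w t * a t `^ r by rewrite mulr_ge0// powR_ge0.
rewrite -nneseries_leP//=; set X := (\sum_(0 <= t <oo) _)%E.
have X0 : (0 <= X)%E by apply: nneseries_ge0 => t _ _; rewrite lee_fin.
have in0 (x : \bar R) : (0 <= x)%E -> x \in `[0%E, +oo%E].
  by move=> x0; rewrite in_itv/= x0 leey.
split=> h.
  have := gt0_ler_poweR (ltW r0) (in0 _ (poweR_ge0 _ _))
    (in0 M%:E ltac:(by rewrite lee_fin)) h.
  rewrite -poweRrM mulVf ?gt_eqF// poweRe1// poweR_EFin; exact.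
have ri : 0 <= r^-1 by rewrite invr_ge0 ltW.
have := gt0_ler_poweR ri (in0 _ X0)
  (in0 (M `^ r)%:E ltac:(by rewrite lee_fin powR_ge0)) h.
by rewrite poweR_EFin -powRrM mulfV ?gt_eqF// powRr1.
Qed.

Lemma seqnorm_le_ooP w a M :
  (seqnorm +oo w a <= M%:E)%E <-> forall t, w t * a t <= M.
Proof.
split=> [h t|h].
  by rewrite -lee_fin; apply: le_trans h; apply: ereal_sup_ubound; exists t.
by apply: ge_ereal_sup => _ [t _ <-]; rewrite lee_fin.
Qed.

Lemma seqnorm_ge0 p w a : p != -oo%E -> (forall t, 0 <= w t) ->
  (forall t, 0 <= a t) -> (0 <= seqnorm p w a)%E.
Proof.
case: p => [r||] //= _ w0 a0; first exact: poweR_ge0.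
apply: (@le_trans _ _ (w 0%N * a 0%N)%:E); first by rewrite lee_fin mulr_ge0.
by apply: ereal_sup_ubound; exists 0%N.
Qed.

Lemma seqnorm_ltyP p w a : p != -oo%E -> (forall t, 0 <= w t) ->
  (forall t, 0 <= a t) ->
  (seqnorm p w a < +oo)%E <->
  exists2 M, 0 <= M & (seqnorm p w a <= M%:E)%E.
Proof.
move=> p1 w0 a0; have s0 := seqnorm_ge0 p1 w0 a0.
split=> [h|[M _ h]]; last by apply: le_lt_trans h _; exact: ltry.
exists (fine (seqnorm p w a)); first exact: fine_ge0.
by rewrite fineK// ge0_fin_numE.
Qed.

Lemma ler_nat_sum u m n : (forall t, 0 <= u t) -> (m <= n)%N ->
  \sum_(0 <= t < m) u t <= \sum_(0 <= t < n) u t.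
Proof.
move=> u0 mn; rewrite [leRHS](big_cat_nat (leq0n m) mn)//= lerDl.
by apply: sumr_ge0.
Qed.

Lemma bounded_sum_cvg u M : (forall t, 0 <= u t) ->
  (forall n, \sum_(0 <= t < n) u t <= M) -> cvgn (series u).
Proof.
move=> u0 uM; apply: nondecreasing_is_cvgn; first by move=> m n; exact: ler_nat_sum.
by exists M => _ [n _ <-]; exact: uM.
Qed.

Lemma bounded_sum_tail u M : (forall t, 0 <= u t) ->
  (forall n, \sum_(0 <= t < n) u t <= M) -> forall e, 0 < e ->
  exists N, forall n, \sum_(N <= t < n) u t <= e.
Proof.
move=> u0 uM e e0; have cu := bounded_sum_cvg u0 uM.
have ndu : {homo series u : n m / (n <= m)%N >-> n <= m}.
  by move=> m n; exact: ler_nat_sum.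
have /cvgrPdist_le /(_ e e0) [N _ /(_ N (leqnn N))] := cu.
have le_lim := nondecreasing_cvgn_le ndu cu.
rewrite ger0_norm ?subr_ge0// => Ne; exists N => n.
have [Nn|/ltnW nN] := leqP N n; last by rewrite big_geq// ltW.
rewrite -(lerD2l (series u N)) -[X in X <= _](big_cat_nat (leq0n N) Nn) /=.
by apply: le_trans (le_lim n) _; rewrite -lerBlDl.
Qed.

Lemma bounded_sum_cvg0 u M : (forall t, 0 <= u t) ->
  (forall n, \sum_(0 <= t < n) u t <= M) -> u @ \oo --> (0 : R).
Proof. by move=> u0 uM; apply: cvg_series_cvg_0; exact: bounded_sum_cvg uM. Qed.

Lemma cvg0_powR u r : 0 < r -> (forall t, 0 <= u t) ->
  u @ \oo --> (0 : R) -> (fun t => u t `^ r) @ \oo --> (0 : R).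
Proof.
move=> r0 u0 /cvgr0Pnorm_le u_0; apply/cvgr0Pnorm_le => e e0.
have := u_0 _ (powR_gt0 r^-1 e0); apply: filterS => t.
rewrite !ger0_norm ?powR_ge0// => /(ge0_ler_powR (ltW r0)).
rewrite -[(e `^ _) `^ r]powRrM mulVf ?gt_eqF// powRr1 ?(ltW e0)//.
by apply; rewrite nnegrE// powR_ge0.
Qed.

Lemma lim_nat_sum_le (f : nat -> nat -> R) (l : nat -> R) n M :
  (forall t, f t @ \oo --> l t) ->
  (forall K, \sum_(0 <= t < n) f t K <= M) -> \sum_(0 <= t < n) l t <= M.
Proof.
move=> fl fM.
have sfl : (fun K => \sum_(0 <= t < n) f t K) @ \oo --> \sum_(0 <= t < n) l t.
  by apply: cvg_big => [|t _]; [exact: add_continuous|exact: fl].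
rewrite -(cvg_lim _ sfl)//; apply: limr_le; last exact: nearW.
by apply/cvg_ex; eexists; exact: sfl.
Qed.

Lemma sum_half_pow n : \sum_(0 <= k < n) (2%:R^-1 : R) ^+ k.+1 = 1 - 2^-1 ^+ n.
Proof.
elim: n => [|n IH]; first by rewrite big_geq// expr0 subrr.
by rewrite big_nat_recr//= IH exprS; lra.
Qed.

(* If [C = k / lam k] failed for every [k], the violating test sequences [g k]
   could be gathered into [alpha = (sum_k 2^-(k+1) (g k)^r)^(1/r)], which
   satisfies [sum alpha^r <= 1] and dominates [lam k * g k] for each [k]. *)
Lemma dual_ball_bounded b r : 0 < r -> (forall t, 0 <= b t) ->
  (forall a, (forall t, 0 <= a t) ->
     (forall n, \sum_(0 <= t < n) a t `^ r <= 1) ->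
     exists M, forall n, \sum_(0 <= t < n) a t * b t <= M) ->
  exists C, forall n a, (forall t, 0 <= a t) ->
    \sum_(0 <= t < n) a t `^ r <= 1 -> \sum_(0 <= t < n) a t * b t <= C.
Proof.
move=> r0 b0 ab; apply/not_existsP => noC.
pose s k := (2%:R^-1 : R) ^+ k.+1.
have s0 k : 0 < s k by rewrite exprn_gt0// invr_gt0.
pose lam k := s k `^ r^-1.
have lam0 k : 0 < lam k by exact: powR_gt0.
have /choice[f fP] k : exists x : nat * (nat -> R),
    [/\ forall t, 0 <= x.2 t, \sum_(0 <= t < x.1) x.2 t `^ r <= 1 &
        k%:R / lam k < \sum_(0 <= t < x.1) x.2 t * b t].
  have /existsNP[n /existsNP[a]] := noC (k%:R / lam k).
  move=> /not_implyP[a0 /not_implyP[a1 /negP]]; rewrite -ltNge => Ca.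
  by exists (n, a).
pose g k t := if (t < (f k).1)%N then (f k).2 t else 0.
have g0 k t : 0 <= g k t by rewrite /g; case: ifP => // _; case: (fP k).
have g1 k n : \sum_(0 <= t < n) g k t `^ r <= 1.
  have [_ + _] := fP k; apply: le_trans.
  apply: (@le_trans _ _ (\sum_(0 <= t < n + (f k).1) g k t `^ r)).
    by apply: ler_nat_sum; [move=> t; exact: powR_ge0|exact: leq_addr].
  rewrite (@big_cat_nat _ _ _ (f k).1)//= ?leq_addl// addrC big_nat big1.
    rewrite add0r big_nat [leRHS]big_nat; apply: ler_sum => t /andP[_ tk].
    by rewrite /g tk.
  by move=> t /andP[tk _]; rewrite /g ltnNge tk powR0// gt_eqF.
have gt1 k t : g k t `^ r <= 1.
  apply: le_trans (g1 k t.+1); rewrite big_nat_recr//= lerDr.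
  by apply: sumr_ge0 => i _; exact: powR_ge0.
pose h t k := s k * g k t `^ r.
have h0 t k : 0 <= h t k by rewrite mulr_ge0 ?powR_ge0 ?ltW.
have s1 K : \sum_(0 <= k < K) s k <= 1.
  by rewrite sum_half_pow gerBl exprn_ge0// invr_ge0.
have hs t K : \sum_(0 <= k < K) h t k <= 1.
  apply: le_trans (s1 K); apply: ler_sum => k _.
  by rewrite -[leRHS]mulr1 ler_wpM2l// ltW.
have ch t := bounded_sum_cvg (h0 t) (hs t).
pose bet t : R := limn (series (h t)).
have hb t k : h t k <= bet t.
  have ndh : {homo series (h t) : n m / (n <= m)%N >-> n <= m}.
    by move=> m n; exact: ler_nat_sum.
  apply: le_trans (nondecreasing_cvgn_le ndh (ch t) k.+1).
  by rewrite /series/= big_nat_recr//= lerDr sumr_ge0.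
have bet0 t : 0 <= bet t by apply: le_trans (hb t 0%N).
have alphar t : (bet t `^ r^-1) `^ r = bet t.
  by rewrite -powRrM mulVf ?gt_eqF// powRr1.
have [M abM] : exists M, forall n, \sum_(0 <= t < n) bet t `^ r^-1 * b t <= M.
  apply: ab => [t|n]; first exact: powR_ge0.
  under eq_bigr do rewrite alphar.
  (* With n fixed, the double sum over t < n and k < K is bounded by the sum of the [s k], and this
     bound survives K -> oo. *)
  apply: (@lim_nat_sum_le (fun t => series (h t)) bet) => [t|K]; first exact: ch.
  rewrite /series/= exchange_big/=; apply: le_trans (s1 K).
  apply: ler_sum => k _; rewrite -mulr_sumr -[leRHS]mulr1.
  by rewrite ler_wpM2l// ltW.
pose k := (Num.truncn `|M|).+1.
have kM : M < k%:R by apply: le_lt_trans (ler_norm M) (truncnS_gt _).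
have [a0 a1 ka] := fP k.
suff : k%:R <= M by rewrite leNgt kM.
apply: le_trans (abM (f k).1).
apply: (@le_trans _ _ (\sum_(0 <= t < (f k).1) lam k * ((f k).2 t * b t))).
  by rewrite -mulr_sumr -ler_pdivrMl// mulrC ltW.
rewrite big_nat [leRHS]big_nat; apply: ler_sum => t /andP[_ tk].
rewrite mulrA ler_wpM2r//.
have -> : lam k * (f k).2 t = h t k `^ r^-1.
  by rewrite /h /g tk powRM ?powR_ge0 ?ltW// -powRrM mulfV ?gt_eqF// powRr1.
by rewrite ge0_ler_powR ?nnegrE// invr_ge0 ltW.
Qed.

(** The uniform constant is tested on the indicator of a single time, which has l^1 norm 1. *)
Lemma dual_l1 b : (forall t, 0 <= b t) ->
  (forall a, (forall t, 0 <= a t) ->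
     (forall n, \sum_(0 <= t < n) a t `^ 1 <= 1) ->
     exists M, forall n, \sum_(0 <= t < n) a t * b t <= M) ->
  exists M, forall t, b t <= M.
Proof.
move=> b0 /(dual_ball_bounded ltr01 b0)[C CP]; exists C => t.
have := CP t.+1 (fun s => (s == t)%:R).
rewrite !big_nat_recr//= eqxx mul1r powR1 big_nat big1 => [|i /andP[_ it]].
  rewrite big_nat big1 ?add0r => [|i /andP[_ it]]; first by apply=> // i.
  by rewrite (ltn_eqF it) mul0r.
by rewrite (ltn_eqF it) powR0// oner_neq0.
Qed.

(** The uniform constant is tested on the equality case of Hölder's inequality: with B the partial
    sum of b^q, the sequence b^(q-1) / B^(1/r) has r-norm 1 up to time n, because (q-1) r = q, and
    its pairing with b is B^(1/q). *)
Lemma dual_lq b r q : 1 < r -> 1 < q -> r^-1 + q^-1 = 1 ->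
  (forall t, 0 <= b t) ->
  (forall a, (forall t, 0 <= a t) ->
     (forall n, \sum_(0 <= t < n) a t `^ r <= 1) ->
     exists M, forall n, \sum_(0 <= t < n) a t * b t <= M) ->
  exists M, forall n, \sum_(0 <= t < n) b t `^ q <= M.
Proof.
move=> r1 q1 rq b0.
have r0 : 0 < r by exact: lt_trans r1.
have q0 : 0 < q by exact: lt_trans q1.
move=> /(dual_ball_bounded r0 b0)[C CP]; exists (C `^ q) => n.
set B := \sum_(0 <= t < n) _.
have B0 : 0 <= B by apply: sumr_ge0 => t _; exact: powR_ge0.
have [->|Bneq] := eqVneq B 0; first exact: powR_ge0.
have Bgt : 0 < B by rewrite lt_neqAle eq_sym Bneq.
have qr : (q - 1) * r = q.
  have : (r^-1 + q^-1) * (r * q) = r * q by rewrite rq mul1r.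
  rewrite mulrDl mulrA mulVf ?gt_eqF// mul1r (mulrC r) mulrA mulVf ?gt_eqF//.
  by rewrite mul1r mulrBl mul1r => <-; rewrite addrK.
have := CP n (fun t => b t `^ (q - 1) / B `^ r^-1) _ _.
have -> : \sum_(0 <= t < n) b t `^ (q - 1) / B `^ r^-1 * b t = B `^ q^-1.
  have -> : q^-1 = 1 - r^-1 by rewrite -rq addrC addKr.
  rewrite powRB ?Bneq ?implybT// powRr1// {2}/B mulr_suml; apply: eq_bigr => t _.
  by rewrite mulrAC [X in X / _]mulrC mulr_powRB1.
move=> BC; have {}BC : B `^ q^-1 <= C.
  apply: BC => [t|]; first by rewrite divr_ge0 ?powR_ge0.
  rewrite (eq_bigr (fun t => b t `^ q / B)) => [|t _].
    by rewrite -mulr_suml divff.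
  rewrite powRM ?powR_ge0 ?invr_ge0 ?powR_ge0// -powRrM qr.
  rewrite -(powR_inv1 (powR_ge0 _ _)) powRAC -[(B `^ r^-1) `^ r]powRrM.
  by rewrite mulVf ?gt_eqF// powRr1// powR_inv1.
have := ge0_ler_powR (ltW q0) (powR_ge0 _ _) (le_trans (powR_ge0 _ _) BC) BC.
by rewrite -powRrM mulVf ?gt_eqF// powRr1.
Qed.

(** Test sequences must vanish at infinity, so the constant 1 is excluded. As in the Abel-Dini
    theorem, if the partial sums B_n diverge then a_t = (1 + B_(t+1))^(-1/2) tends to 0 while the
    sum of a_t b_t over t < n is at least B_n / sqrt(1 + B_n), which is unbounded. *)
Lemma dual_c0 b : (forall t, 0 <= b t) ->
  (forall a, (forall t, 0 <= a t <= 1) -> a @ \oo --> (0 : R) ->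
     exists M, forall n, \sum_(0 <= t < n) a t * b t <= M) ->
  exists M, forall n, \sum_(0 <= t < n) b t <= M.
Proof.
move=> b0 ab; apply/not_existsP => noM.
pose B n := \sum_(0 <= t < n) b t.
have B0 n : 0 <= B n by exact: sumr_ge0.
have Bnd m n : (m <= n)%N -> B m <= B n by exact: ler_nat_sum.
have Bbig M : exists n, M < B n.
  by have /existsNP[n /negP] := noM M; rewrite -ltNge; exists n.
pose a t : R := (Num.sqrt (1 + B t.+1))^-1.
have rt1 n : 1 <= Num.sqrt (1 + B n) by rewrite -{1}sqrtr1 ler_wsqrtr// lerDl.
have rt0 n : 0 < Num.sqrt (1 + B n) by exact: lt_le_trans (rt1 n).
have /ab : forall t, 0 <= a t <= 1.
  by move=> t; rewrite invr_ge0 sqrtr_ge0 invf_le1 ?rt1.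
case=> [|M abM].
  apply/cvgr0Pnorm_le => e e0; have [n nB] := Bbig (e^-1 ^+ 2).
  exists n => // t /= nt; rewrite ger0_norm ?invr_ge0 ?sqrtr_ge0//.
  rewrite invf_ple ?posrE// -(ger0_norm (_ : 0 <= e^-1)) ?invr_ge0 ?(ltW e0)//.
  rewrite -sqrtr_sqr ler_wsqrtr// (le_trans (ltW nB))//.
  by rewrite (le_trans (Bnd n t.+1 (leqW nt)))// lerDr.
have sq n : Num.sqrt (1 + B n) ^+ 2 = 1 + B n by rewrite sqr_sqrtr// addr_ge0.
(* With x = sqrt(1 + B_n) > 1 + |M|, the quotient B_n / x = x - 1/x is at least x - 1 > |M|. *)
have [n nB] := Bbig ((1 + `|M|) ^+ 2).
suff : B n / Num.sqrt (1 + B n) <= M.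
  apply/negP; rewrite -ltNge ltr_pdivlMr//.
  have x1 := rt1 n; have x2 := sq n; set x := Num.sqrt _ in x1 x2 *.
  have Mx : 1 + `|M| < x.
    rewrite -(ltr_pXn2r (ltn0Sn 1)) ?nnegrE ?x2//; last by rewrite (le_trans _ x1).
    by rewrite (lt_le_trans nB)// lerDr.
  have BE : B n = x ^+ 2 - 1 by rewrite x2 addrC addKr.
  by rewrite BE; have := ler_norm M; nra.
apply: le_trans (abM n); rewrite {1}/B mulr_suml big_nat [leRHS]big_nat.
apply: ler_sum => t /andP[_ tn]; rewrite mulrC ler_wpM2r// lef_pV2 ?posrE//.
by rewrite ler_wsqrtr// lerD2l Bnd.
Qed.

End RealSequences.

(** * Weights *)

Section Weights.
Context {R : realType}.
Implicit Types (w a b c v x : nat -> R) (M K r p q e : R).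

(* The square root of the tail sums [T_t] works:
   [(T_t - T_(t+1)) / sqrt T_t <= 2 (sqrt T_t - sqrt T_(t+1))] telescopes.
   The geometric term keeps the tails positive. *)
Lemma summable_weight c M : (forall t, 0 <= c t) ->
  (forall n, \sum_(0 <= t < n) c t <= M) ->
  exists2 v, weighting v &
    exists2 K, 0 <= K & forall n, \sum_(0 <= t < n) c t / v t <= K.
Proof.
move=> c0 cM; pose d t := c t + (2%:R^-1 : R) ^+ t.+1.
have d0 t : 0 < d t by rewrite ltr_wpDl// exprn_gt0// invr_gt0.
have dM n : \sum_(0 <= t < n) d t <= M + 1.
  rewrite big_split/= lerD ?cM// sum_half_pow gerBl.
  by rewrite exprn_ge0// invr_ge0.
have cd := bounded_sum_cvg (fun t => ltW (d0 t)) dM.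
have ndd : {homo series d : n m / (n <= m)%N >-> n <= m}.
  by move=> m n; apply: ler_nat_sum => t; exact: ltW.
have le_lim := nondecreasing_cvgn_le ndd cd.
pose T n : R := limn (series d) - series d n.
have TS n : T n.+1 = T n - d n.
  by rewrite /T /series/= big_nat_recr//= opprD addrA.
have T0 n : 0 < T n.
  have := le_lim n.+1; rewrite -subr_ge0 -/(T n.+1) TS subr_ge0.
  exact: lt_le_trans.
have Tni m n : (m <= n)%N -> T n <= T m.
  by move=> mn; rewrite lerB// ndd.
have Tcvg : T @ \oo --> (0 : R).
  rewrite -(subrr (limn (series d))); apply: cvgB => //; exact: cvg_cst.
pose s n := Num.sqrt (T n).
have s0 n : 0 < s n by rewrite sqrtr_gt0.
have sE n : s n ^+ 2 = T n by rewrite sqr_sqrtr// ltW.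
have sni m n : (m <= n)%N -> s n <= s m.
  by move=> mn; rewrite ler_wsqrtr// Tni.
(* Dividing by the largest value places the weight in (0,1]. *)
exists (fun t => s t / s 0%N).
  split=> [m n mn|t|].
  - by rewrite ler_wpM2r ?invr_ge0 ?(ltW (s0 _)) ?sni.
  - by rewrite divr_gt0//= ler_pdivrMr// mul1r sni.
  - rewrite -(mul0r (s 0%N)^-1); apply: cvgMr_tmp.
    have := cvg0_powR (_ : 0 < 2^-1) (fun t => ltW (T0 t)) Tcvg.
    rewrite invr_gt0 => /(_ (ltr0n _ 2)).
    by under eq_fun do rewrite powR12_sqrt ?ltW//.
(* The telescoping sum is 2 s_0 (s_0 - s_n), at most 2 s_0^2 = 2 T_0. *)
exists (2 * T 0%N) => [|n]; first by rewrite mulr_ge0// ltW.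
apply: (@le_trans _ _ (\sum_(0 <= t < n) (2 * s 0%N * (- s t.+1 - - s t)))).
  apply: ler_sum => t _.
  have -> : c t / (s t / s 0%N) = s 0%N * (c t / s t) by rewrite invf_div mulrCA.
  rewrite [2 * _]mulrC -mulrA ler_pM2l//.
  have cT : c t <= s t ^+ 2 - s t.+1 ^+ 2.
    by rewrite !sE TS opprB addrCA subrr addr0 lerDl exprn_ge0// invr_ge0.
  rewrite ler_pdivrMr//; apply: le_trans cT _.
  by have := sni _ _ (leqnSn t); have := s0 t.+1; nra.
rewrite -mulr_sumr telescope_sumr// -sE.
by have := s0 n; have := s0 0%N; nra.
Qed.

Lemma weighting_powR w r : 0 < r -> weighting w ->
  weighting (fun t => w t `^ r).
Proof.
move=> r0 [w_ni w01 w_0].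
have w0 t : 0 <= w t by have /andP[/ltW] := w01 t.
split=> [m n mn|t|]; last exact: cvg0_powR.
  by rewrite ge0_ler_powR ?nnegrE ?(ltW r0) ?w_ni.
have /andP[wt0 wt1] := w01 t; rewrite powR_gt0//=.
have := ge0_ler_powR (ltW r0) (w0 t) ler01 wt1.
by rewrite powR1.
Qed.

(** The least nonincreasing majorant of a null sequence, the supremum of its tails, is again null.
    The harmonic term added to b keeps it positive, and dividing by its value at 0 normalizes it,
    which gives the constant K. *)
Lemma vanishing_weight b : (forall t, 0 <= b t) -> b @ \oo --> (0 : R) ->
  exists2 v, weighting v & exists2 K, 0 <= K & forall t, b t <= K * v t.
Proof.
move=> b0 b_0.
pose u t := b t + t.+1%:R^-1.
have u0 t : 0 < u t by rewrite ltr_wpDl// invr_gt0.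
have u_0 : u @ \oo --> (0 : R).
  rewrite -[0]addr0; apply: cvgD => //; exact: cvg_harmonic.
have [B uB] : exists B, forall t, u t <= B.
  have /cvg_seq_bounded[B [_ /(_ (B + 1))]] : cvgn u by apply/cvg_ex; exists 0.
  rewrite ltrDl ltr01 => /(_ isT) h; exists (B + 1) => t.
  by apply: le_trans (ler_norm _) _; apply: h.
pose m t := sup [set u s | s in [set s | (t <= s)%N]].
have has t : has_sup [set u s | s in [set s | (t <= s)%N]].
  split; first by exists (u t); exists t => //=.
  by exists B => _ [s _ <-].
have um s t : (t <= s)%N -> u s <= m t.
  by move=> ts; apply: ub_le_sup; [case: (has t)|exists s].
have m0 t : 0 < m t by apply: lt_le_trans (um t t _).
have mni i j : (i <= j)%N -> m j <= m i.
  move=> ij; apply: ge_sup; first by case: (has j).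
  by move=> _ [s js <-]; rewrite um// (leq_trans ij).
exists (fun t => m t / m 0%N).
  split=> [i j ij|t|].
  - by rewrite ler_wpM2r ?invr_ge0 ?(ltW (m0 _)) ?mni.
  - by rewrite divr_gt0//= ler_pdivrMr// mul1r mni.
  - rewrite -(mul0r (m 0%N)^-1); apply: cvgMr_tmp.
    apply/cvgr0Pnorm_le => e e0.
    have /cvgr0Pnorm_le/(_ e e0)[N _ Ne] := u_0.
    exists N => // t /= Nt; rewrite ger0_norm ?(ltW (m0 t))//.
    apply: ge_sup; first by case: (has t).
    move=> _ [s /= ts <-]; apply: le_trans (ler_norm _) _.
    by apply: Ne => /=; exact: leq_trans ts.
exists (m 0%N) => [|t]; first exact: ltW.
rewrite mulrCA divff ?gt_eqF// mulr1; apply: le_trans (um t t _) => //.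
by rewrite lerDl invr_ge0.
Qed.

(** Continuity at 0 of the pairing with b, on all nonnegative sequences so that it applies to |x_t -
    z_t|. Bounding partial sums uniformly in n avoids any prior convergence of the series. *)
Definition dominated (p : \bar R) w b := forall e, 0 < e ->
  exists2 d, 0 < d & forall x, (forall t, 0 <= x t) ->
    (seqnorm p w x <= d%:E)%E -> forall n, \sum_(0 <= t < n) b t * x t <= e.

Lemma dominated1 w b K : 0 <= K -> (forall t, 0 <= w t) ->
  (forall t, b t <= K * w t) -> dominated 1%E w b.
Proof.
move=> K0 w0 bK e e0.
(* K may be 0, so the division is by K + 1. *)
have K1 : 0 < K + 1 by rewrite ltr_wpDl.
have d0 : 0 < e / (K + 1) by rewrite divr_gt0.
exists (e / (K + 1)) => // x x0.
move=> /(seqnorm_leP _ ltr01 (ltW d0) w0) h n.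
apply: (@le_trans _ _ (K * \sum_(0 <= t < n) w t * x t `^ 1)).
  by rewrite mulr_sumr ler_sum// => t _; rewrite powRr1// mulrA ler_wpM2r.
have := h n; rewrite powRr1 ?(ltW d0)// => hn.
apply: le_trans (ler_wpM2l K0 hn) _.
by rewrite mulrCA ger_pMr// ler_pdivrMr// mul1r lerDl.
Qed.

Lemma dominated_oo w b K : 0 <= K -> (forall t, 0 < w t) ->
  (forall t, 0 <= b t) ->
  (forall n, \sum_(0 <= t < n) b t / w t <= K) -> dominated +oo%E w b.
Proof.
move=> K0 w0 b0 bK e e0.
have K1 : 0 < K + 1 by rewrite ltr_wpDl.
have d0 : 0 < e / (K + 1) by rewrite divr_gt0.
exists (e / (K + 1)) => // x x0 /seqnorm_le_ooP h n.
apply: (@le_trans _ _ ((\sum_(0 <= t < n) b t / w t) * (e / (K + 1)))).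
  rewrite mulr_suml ler_sum// => t _; rewrite -mulrA ler_wpM2l//.
  by rewrite mulrC ler_pdivlMr// mulrC.
apply: le_trans (ler_wpM2r (ltW d0) (bK n)) _.
by rewrite mulrCA ger_pMr// ler_pdivrMr// mul1r lerDl.
Qed.

(* Young's inequality for [(l b v^(-1/q)) * (v^(1/q) x / l)], with [l] small
   enough to control the first term uniformly in [x]. *)
Lemma dominated_powR v b p q K : 1 < p -> 1 < q -> p^-1 + q^-1 = 1 ->
  (forall t, 0 < v t) -> (forall t, 0 <= b t) -> 0 <= K ->
  (forall n, \sum_(0 <= t < n) b t `^ q / v t <= K) ->
  dominated p%:E (fun t => v t `^ (p / q)) b.
Proof.
move=> p1 q1 pq v0 b0 K0 bK e e0.
have p0 : 0 < p by exact: lt_trans p1.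
have q0 : 0 < q by exact: lt_trans q1.
have K1 : 0 < K + 1 by rewrite ltr_wpDl.
have e2 : 0 < e / 2 by rewrite divr_gt0.
have e2K : 0 < e / 2 / (K + 1) by rewrite divr_gt0.
pose l := (e / 2 / (K + 1)) `^ q^-1.
have l0 : 0 < l by exact: powR_gt0.
have lq : l `^ q = e / 2 / (K + 1).
  by rewrite /l -powRrM mulVf ?gt_eqF// powRr1// ltW.
(* Chosen so that d^p / l^p = e/2, the share of e left to the second Young term. *)
pose d := l * (e / 2) `^ p^-1.
have d0 : 0 < d by rewrite mulr_gt0// powR_gt0.
have dp : d `^ p = l `^ p * (e / 2).
  by rewrite powRM ?powR_ge0 ?(ltW l0)// -powRrM mulVf ?gt_eqF// powRr1// ltW.
exists d => // x x0.
move=> /(seqnorm_leP _ p0 (ltW d0) (fun t => powR_ge0 (v t) _)) h n.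
apply: (@le_trans _ _ (\sum_(0 <= t < n)
    (l `^ q * (b t `^ q / v t) + (v t `^ (p / q) * x t `^ p) / l `^ p))).
  apply: ler_sum => t _.
  have vq0 : 0 < v t `^ q^-1 by exact: powR_gt0.
  have -> : b t * x t = (v t `^ q^-1 * x t / l) * (l * b t / v t `^ q^-1).
    by field; rewrite !gt_eqF.
  have A0 : 0 <= v t `^ q^-1 * x t / l by rewrite divr_ge0 ?mulr_ge0// ltW.
  have B0 : 0 <= l * b t / v t `^ q^-1 by rewrite divr_ge0 ?mulr_ge0// ltW.
  apply: le_trans (conjugate_powR A0 B0 p0 q0 pq) _.
  have invp (y r : R) : 0 < y -> (y^-1) `^ r = (y `^ r)^-1.
    by move=> y0; rewrite -(powR_inv1 (ltW y0)) powRAC powR_inv1// powR_ge0.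
  have -> : (v t `^ q^-1 * x t / l) `^ p = v t `^ (p / q) * x t `^ p / l `^ p.
    rewrite !powRM ?mulr_ge0 ?invr_ge0 ?(ltW vq0) ?(ltW l0)// invp//.
    by rewrite -powRrM [q^-1 * _]mulrC.
  have -> : (l * b t / v t `^ q^-1) `^ q = l `^ q * (b t `^ q / v t).
    rewrite !powRM ?mulr_ge0 ?invr_ge0 ?(ltW vq0) ?(ltW l0)// invp//.
    by rewrite -powRrM mulVf ?gt_eqF// powRr1 ?ltW// mulrA.
  (* The factors 1/p and 1/q in Young's inequality are at most 1 and are bounded away. *)
  rewrite addrC lerD// ler_pdivrMr// ler_peMr ?(ltW p1) ?(ltW q1)//.
    by rewrite mulr_ge0 ?divr_ge0 ?powR_ge0 ?(ltW (v0 t)).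
  by rewrite divr_ge0 ?mulr_ge0 ?powR_ge0.
rewrite big_split/= -mulr_sumr -mulr_suml [leRHS](splitr e) lerD//.
  rewrite lq; apply: le_trans (ler_wpM2l (ltW e2K) (bK n)) _.
  by rewrite mulrAC -mulrA ger_pMr// ler_pdivrMr// mul1r lerDl.
by rewrite ler_pdivrMr ?powR_gt0// [leRHS]mulrC -dp.
Qed.

End Weights.

(** * Finite-dimensional targets and operator norms *)

Section NormedSpaces.
Context {R : realType}.

(* A spanning family of minimal size is linearly independent, so by
   compactness of the unit sphere of [R^n] its coordinates are bounded. *)
Lemma findim_coord (Y : normedModType R) : findim Y ->
  exists n (e : 'I_n -> Y) (C : R),
    [/\ forall y : Y, exists c : 'rV[R]_n, y = \sum_(i < n) c 0 i *: e i,
        0 <= C &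
        forall (c : 'rV[R]_n) i, `|c 0 i| <= C * `|\sum_(i < n) c 0 i *: e i| ].
Proof.
move=> fY.
have ex : exists n, `[< exists e : 'I_n -> Y, forall y : Y,
    exists c : 'rV[R]_n, y = \sum_(i < n) c 0 i *: e i >].
  have [n [e eP]] := fY; exists n; apply/asboolP; exists e => y.
  have [c ->] := eP y; exists (\row_i c i).
  by apply: eq_bigr => i _; rewrite mxE.
case: (ex_minnP ex) => n /asboolP[e eP] nmin.
exists n, e.
pose f (c : 'rV[R]_n) := \sum_(i < n) c 0 i *: e i.
have fZ a c : f (a *: c) = a *: f c.
  by rewrite /f scaler_sumr; apply: eq_bigr => i _; rewrite mxE scalerA.
have indep c : f c = 0 -> c = 0.
  move=> fc0; apply/rowP => i; rewrite mxE; apply/eqP/negP => /negP ci0.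
  case: n => [|n] in e eP nmin f fZ c fc0 i ci0 *; first by case: i {ci0}.
  suff : (n.+1 <= n)%N by rewrite ltnn.
  apply: nmin; apply/asboolP; exists (fun j => e (lift i j)) => y.
  have [d ->] := eP y.
  (* Subtracting the multiple d_i / c_i of the relation [f c = 0] cancels coordinate i, so the
     family without e_i still spans, against minimality. *)
  exists (\row_j (d 0 (lift i j) - d 0 i / c 0 i * c 0 (lift i j))).
  have : f d = f d - (d 0 i / c 0 i) *: f c by rewrite fc0 scaler0 subr0.
  rewrite {1}/f => ->; rewrite /f scaler_sumr -sumrB.
  rewrite (bigD1_ord i)//= scalerA divfK// subrr add0r.
  by apply: eq_bigr => j _; rewrite mxE scalerBl scalerA.
have fcont : continuous (fun c : 'rV[R]_n => `|f c|).
  have fc : continuous f.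
    apply: continuous_big => [|i _ c]; first exact: add_continuous.
    apply: (@cvgZr_tmp _ _ _ (nbhs c) (nbhs_filter c)
      (fun M : 'rV[R]_n => M 0 i) (c 0 i) (e i)).
    exact: coord_continuous.
  by move=> c; apply: (continuous_comp (fc c)); exact: norm_continuous.
pose A : set 'rV[R]_n := [set c | `|c| = 1].
have cA : compact A.
  apply: bounded_closed_compact.
    by exists 1; split => // M M1 c; rewrite /A/= => ->; exact: ltW.
  apply: (@preimage_closed _ _ (fun c : 'rV[R]_n => `|c|) [set 1]) => [c _|].
    exact: norm_continuous.
  exact: closed_eq.
(* An empty sphere means that 0 is the only row vector, and the constant 0 works. *)
have [[a Aa]|A0] := pselect (A !=set0); last first.
  exists 0; split => // c i; rewrite mul0r normr_le0.
  have [->|c0] := eqVneq c 0; first by rewrite mxE.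
  exfalso; apply: A0; exists (`|c|^-1 *: c); rewrite /A/= normrZ normfV normr_id.
  by rewrite mulVf// normr_eq0.
have [c0 /set_mem Ac0 c0min] := compact_EVT_min (ex_intro _ a Aa) cA
  (continuous_subspaceT fcont).
have m0 : 0 < `|f c0|.
  rewrite normr_gt0; apply/eqP => /indep c00.
  by move: Ac0; rewrite c00 /A/= normr0 => /eqP; rewrite eq_sym oner_eq0.
exists `|f c0|^-1; split => // c i.
have le_c : `|c 0 i| <= `|c|.
  by rewrite [leRHS]mx_normrE; apply: (le_bigmax _ _ (0, i)).
apply: le_trans le_c _.
have [->|cn0] := eqVneq c 0; first by rewrite normr0 mulr_ge0// invr_ge0.
have nc0 : 0 < `|c| by rewrite normr_gt0.
have : `|f c0| <= `|f (`|c|^-1 *: c)|.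
  apply: c0min; rewrite inE /A/= normrZ normfV normr_id mulVf//.
  by rewrite normr_eq0.
by rewrite fZ normrZ normfV normr_id -/(f c) !ler_pdivlMl// mulrC.
Qed.

(** Boundedness passes from the sums over J to each coordinate. Taking for J the times where a
    coordinate is nonnegative, then its complement, bounds the sum of its absolute values; finitely
    many coordinates control the norm. *)
Lemma findim_unconditional (Y : normedModType R) (y : nat -> Y) : findim Y ->
  (forall J : set nat, cvgn (fun n => \sum_(0 <= t < n) if `[< J t >] then y t else 0)) ->
  exists M : R, forall n, \sum_(0 <= t < n) `|y t| <= M.
Proof.
move=> /findim_coord[m [e [C [espan C0 eC]]]] cJ.
have /choice[c cP] t := espan (y t).
have bdJ J : exists M : R, forall n,
    `|\sum_(0 <= t < n) if `[< J t >] then y t else 0| <= M.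
  have /cvg_seq_bounded[B [_ /(_ (B + 1))]] := cJ J.
  by rewrite ltrDl ltr01 => /(_ isT) h; exists (B + 1) => t; apply: h.
have coordJ i (J : set nat) : exists M : R, forall n,
    `|\sum_(0 <= t < n) if `[< J t >] then c t 0 i else 0| <= M.
  have [M MP] := bdJ J; exists (C * M) => n.
  pose cn : 'rV[R]_m := \sum_(0 <= t < n) if `[< J t >] then c t else 0.
  have -> : \sum_(0 <= t < n) (if `[< J t >] then c t 0 i else 0) = cn 0 i.
    rewrite /cn summxE; apply: eq_bigr => t _; case: ifP => //.
    by rewrite mxE.
  apply: le_trans (eC cn i) _; apply: ler_wpM2l => //.
  suff -> : \sum_(j < m) cn 0 j *: e j =
    \sum_(0 <= t < n) if `[< J t >] then y t else 0 by exact: MP.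
  under eq_bigr do rewrite /cn summxE scaler_suml.
  rewrite exchange_big/=; apply: eq_bigr => t _.
  by case: ifP => _; [rewrite cP|rewrite big1// => j _; rewrite mxE scale0r].
have absi i : exists M : R, forall n, \sum_(0 <= t < n) `|c t 0 i| <= M.
  have [M1 P1] := coordJ i [set t | 0 <= c t 0 i].
  have [M2 P2] := coordJ i [set t | ~ (0 <= c t 0 i)].
  exists (M1 + M2) => n.
  apply: le_trans (lerD (P1 n) (P2 n)); rewrite -[X in _ <= _ + X]normrN.
  apply: le_trans (lerD (ler_norm _) (ler_norm _)).
  rewrite -sumrN -big_split/= ler_sum// => t _.
  rewrite asbool_neg !asboolb; case: (ler0P (c t 0 i)) => /=; case: ltgtP => //=.
  - by rewrite add0r.
  - by move=> ->; rewrite oppr0 addr0.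
  - by rewrite oppr0 addr0.
have /choice[M MP] := absi.
exists (\sum_(i < m) M i * `|e i|) => n.
apply: (@le_trans _ _ (\sum_(0 <= t < n) \sum_(i < m) `|c t 0 i| * `|e i|)).
  apply: ler_sum => t _; rewrite {1}cP; apply: le_trans (ler_norm_sum _ _ _) _.
  by apply: ler_sum => i _; rewrite normrZ.
rewrite exchange_big/=; apply: ler_sum => i _.
by rewrite -mulr_suml ler_wpM2r.
Qed.

Context {Z Y : normedModType R}.
Implicit Types (f : {linear Z -> Y}).

Lemma opnorm_has_sup f : continuous f ->
  has_sup [set `|f z| | z in [set z : Z | `|z| <= 1]].
Proof.
move=> /linear_bounded_continuous/linear_boundedP[M [_ /(_ (`|M| + 1))]].
rewrite (le_lt_trans (ler_norm M)) ?ltrDl// => /(_ isT) fM; split.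
  by exists `|f 0|, 0 => //=; rewrite normr0.
exists (`|M| + 1) => _ [z /= z1 <-]; apply: le_trans (fM z) _.
by rewrite ler_piMr// addr_ge0.
Qed.

Lemma opnorm_ub f z : continuous f -> `|z| <= 1 -> `|f z| <= opnorm f.
Proof.
by move=> /opnorm_has_sup[_ ub] z1; apply: ub_le_sup => //; exists z.
Qed.

Lemma opnorm_ge0 f : continuous f -> 0 <= opnorm f.
Proof. by move=> fc; apply: le_trans (opnorm_ub fc (_ : `|0| <= 1)); rewrite ?normr0. Qed.

Lemma opnorm_le f M : (forall z, `|z| <= 1 -> `|f z| <= M) -> opnorm f <= M.
Proof.
move=> fM; apply: ge_sup; first by exists `|f 0|, 0 => //=; rewrite normr0.
by move=> _ [z /= z1 <-]; exact: fM.
Qed.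

Lemma ler_opnorm f z : continuous f -> `|f z| <= opnorm f * `|z|.
Proof.
move=> fc; have [->|z0] := eqVneq z 0; first by rewrite linear0 !normr0 mulr0.
have nz : 0 < `|z| by rewrite normr_gt0.
rewrite -ler_pdivrMr// mulrC -[`|z|^-1]ger0_norm ?invr_ge0// -normrZ -linearZ.
by apply: opnorm_ub => //; rewrite normrZ normfV normr_id mulVf// gt_eqF.
Qed.

(** The supremum need not be attained; half of it with a non-strict inequality always is reached,
    also when the norm is 0. *)
Lemma opnorm_half f : continuous f ->
  exists2 u, `|u| <= 1 & opnorm f / 2 <= `|f u|.
Proof.
move=> fc; apply/not_exists2P => fu.
have ub z : `|z| <= 1 -> `|f z| < opnorm f / 2.
  by move=> z1; rewrite ltNge; apply/negP => h; case: (fu z).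
have := opnorm_le (fun z z1 => ltW (ub z z1)).
have := le_lt_trans (normr_ge0 _) (ub 0 _); rewrite normr0 => /(_ ler01).
by lra.
Qed.

End NormedSpaces.

(** * Functionals and convolution kernels *)

Section SequenceNorms.
Context {R : realType}.
Implicit Types (w a b : nat -> R) (r M d : R) (p : \bar R).

Lemma seqnorm_mono p w w' a a' : (0 <= p)%E ->
  (forall t, 0 <= w t <= w' t) -> (forall t, 0 <= a t <= a' t) ->
  (seqnorm p w a <= seqnorm p w' a')%E.
Proof.
move=> p0 ww aa.
have w0 t : 0 <= w t by have /andP[] := ww t.
have lww t : w t <= w' t by have /andP[] := ww t.
have a0 t : 0 <= a t by have /andP[] := aa t.
have laa t : a t <= a' t by have /andP[] := aa t.
case: p p0 => [r||] //=.
  rewrite lee_fin => r0.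
  have pos w1 a1 : (forall t, 0 <= w1 t) ->
      (0 <= \sum_(0 <= t <oo) (w1 t * a1 t `^ r)%:E)%E.
    by move=> w10; apply: nneseries_ge0 => t _ _; rewrite lee_fin mulr_ge0 ?powR_ge0.
  apply: gt0_ler_poweR; rewrite ?invr_ge0// ?in_itv/= ?leey ?andbT; try exact: pos.
    by apply: pos => t; exact: le_trans (lww t).
  apply: lee_nneseries => t _; first by rewrite lee_fin mulr_ge0 ?powR_ge0.
  rewrite lee_fin ler_pM ?powR_ge0// ge0_ler_powR ?nnegrE//.
  exact: le_trans (laa t).
move=> _; apply: ge_ereal_sup => _ [t _ <-].
apply: (@le_trans _ _ (w' t * a' t)%:E); first by rewrite lee_fin ler_pM.
by apply: ereal_sup_ubound; exists t.
Qed.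

Lemma seqnorm_lty_sumP r w a : 0 < r -> (forall t, 0 <= w t) ->
  (forall t, 0 <= a t) ->
  (seqnorm r%:E w a < +oo)%E <->
  exists M, forall n, \sum_(0 <= t < n) w t * a t `^ r <= M.
Proof.
move=> r0 w0 a0; split.
  move=> /seqnorm_ltyP[]// M M0 /(seqnorm_leP _ r0 M0 w0) h.
  by exists (M `^ r).
move=> [M h]; apply/seqnorm_ltyP => //.
have M0 : 0 <= M by have := h 0%N; rewrite big_geq.
exists (M `^ r^-1); first exact: powR_ge0.
apply/seqnorm_leP => //; first exact: powR_ge0.
by rewrite -powRrM mulVf ?gt_eqF// powRr1.
Qed.

Lemma seqnorm_single_le r w a t M : 0 < r -> 0 <= M -> (forall t, 0 <= w t) ->
  (forall s, s != t -> a s = 0) -> w t * a t `^ r <= M `^ r ->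
  (seqnorm r%:E w a <= M%:E)%E.
Proof.
move=> r0 M0 w0 as0 aM; apply/seqnorm_leP => // n.
have z s : s != t -> w s * a s `^ r = 0.
  by move=> st; rewrite as0// powR0 ?mulr0// gt_eqF.
have [tn|nt] := ltnP t n; last first.
  rewrite big_nat big1 ?powR_ge0// => s /andP[_ sn].
  by rewrite z// ltn_eqF// (leq_trans sn).
rewrite (bigD1_seq t) ?mem_index_iota ?iota_uniq//=.
by rewrite big1 ?addr0// => s; exact: z.
Qed.

Lemma seqnorm_oo_single_le w a t M : 0 <= M ->
  (forall s, s != t -> a s = 0) -> w t * a t <= M ->
  (seqnorm +oo w a <= M%:E)%E.
Proof.
move=> M0 as0 aM; apply/seqnorm_le_ooP => s.
by have [->//|st] := eqVneq s t; rewrite as0// mulr0.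
Qed.

End SequenceNorms.

(** * Kernels of linear functionals and their continuity properties *)

Section Functionals.
Context {R : realType} {Z Y : normedModType R}.
Implicit Types (S : set (nat -> Z)) (H : (nat -> Z) -> Y) (z : nat -> Z).
Implicit Types (k : nat -> {linear Z -> Y}) (p : \bar R) (w : nat -> R).

Lemma trunc_in S z n : standing S -> S z -> S (trunc n z).
Proof.
move=> [_ _ _ SJ] Sz; have := SJ z Sz [set t | (t <= n)%N].
by congr S; apply/funext => t; rewrite asboolb.
Qed.

Lemma linear_bundle (f : Z -> Y) :
  (forall (a : R) u v, f (a *: u + v) = a *: f u + f v) ->
  exists g : {linear Z -> Y}, forall x, g x = f x.
Proof.
move=> fl; pose fL := GRing.isLinear.Build R Z Y *:%R f fl.
by exists (HB.pack_for {linear Z -> Y} f fL).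
Qed.

(** [S] is only known to contain delta^t x for |x| <= 1, so the kernel is read off the linear
    extension [L] on the span. [trunc n] keeps n + 1 entries, hence the range up to [n.+1]. *)
Lemma linear_kernel S H : standing S -> linear_on S H ->
  exists k, (forall t (x : Z), `|x| <= 1 -> H (delta t x) = k t x) /\
    forall z, S z -> forall n, H (trunc n z) = \sum_(0 <= t < n.+1) k t (z t).
Proof.
move=> St [L [Llin HL]].
have Sspan z : S z -> lspan S z.
  move=> Sz; exists 1%N, (fun=> 1), (fun=> z); split => //.
  by apply/funext => t; rewrite big_ord1 scale1r.
have dspan t x : lspan S (delta t x).
  have [_ _ Sd _] := St.
  (* Normalizing x brings it into the unit ball; for x = 0 the inverse is 0 by convention and the
     vector stays 0. *)
  exists 1%N, (fun=> `|x|), (fun=> delta t (`|x|^-1 *: x)); split => [_|].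
    apply: Sd; rewrite normrZ normfV normr_id.
    by have [->|x0] := eqVneq x 0; rewrite ?normr0 ?mulr0// mulVf// normr_eq0.
  apply/funext => s; rewrite big_ord1 /delta; case: ifP; rewrite ?scaler0// => _.
  have [->|x0] := eqVneq x 0; first by rewrite !scaler0.
  by rewrite scalerA divff ?scale1r// normr_eq0.
have /choice[k kE] t : exists g : {linear Z -> Y}, forall x, g x = L (delta t x).
  apply: linear_bundle => a u v; rewrite -Llin//; congr L.
  by apply/funext => s; rewrite /delta; case: ifP; rewrite ?scaler0 ?addr0.
exists k; split=> [t x x1|z Sz n].
  by rewrite kE HL//; have [_ _ Sd _] := St; exact: Sd.
elim: n => [|n IH].
  rewrite big_nat1 kE HL; last exact: trunc_in.
  by congr L; apply/funext => -[].
rewrite big_nat_recr//= -IH kE !HL; [|exact: trunc_in..].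
rewrite addrC -[L (delta _ _)]scale1r -(Llin _ _ _ (dspan _ _)).
  congr L; apply/funext => t; rewrite /trunc /delta scale1r.
  have [->|tn] := eqVneq t n.+1; first by rewrite leqnn ltnn addr0.
  by rewrite add0r leq_eqVlt (negbTE tn) ltnS.
by apply: Sspan; exact: trunc_in.
Qed.

(** The partial sums are eventually constant. This lets the kernel of a given representation be
    recovered from H on the delta sequences. *)
Lemma conv_rep_finite S H k z n : conv_rep S H k -> S z ->
  (forall t, (n < t)%N -> z t = 0) -> H z = \sum_(0 <= t < n.+1) k t (z t).
Proof.
move=> [[_ kH] _] Sz z0; have := kH z Sz.
have hY := @norm_hausdorff _ Y; move/(cvg_lim hY) <-; apply: (cvg_lim hY).
apply: cvg_near_cst; exists n => // m /= nm.
rewrite (@big_cat_nat _ _ _ n.+1)//= addrC big_nat big1 ?add0r//.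
by move=> t /andP[nt _]; rewrite z0// linear0.
Qed.

Lemma conv_rep_delta S H k t x : standing S -> conv_rep S H k ->
  `|x| <= 1 -> H (delta t x) = k t x.
Proof.
move=> [_ _ Sd _] kH x1; rewrite (conv_rep_finite kH (Sd t x x1) (n := t)).
  rewrite big_nat_recr//= big_nat big1 ?add0r /delta ?eqxx// => s /andP[_ st].
  by rewrite ltn_eqF// linear0.
by move=> s ts; rewrite /delta gtn_eqF.
Qed.

Lemma conv_rep_minimal S H k : standing S -> conv_rep S H k ->
  minimal_FMP S H /\ minimally_continuous H.
Proof.
move=> St kH; split=> [z Sz|t].
  have [[_ /(_ z Sz) cz] _] := kH; apply: cvg_trans cz.
  apply: near_eq_cvg; apply: nearW => n.
  rewrite (conv_rep_finite kH (trunc_in n St Sz) (n := n)).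
    by apply: eq_big_nat => t /andP[_ tn]; rewrite /trunc -ltnS tn.
  by move=> t nt; rewrite /trunc leqNgt nt.
have [[kc _] _] := kH.
apply/subspace_continuousP => x /= x1; apply/cvgrPdist_lt => e e0.
have /cvgrPdist_lt/(_ e e0) := kc t x; apply: filterS => y /= xy y1.
by rewrite /from_subspace !(conv_rep_delta _ St kH).
Qed.

Lemma minimal_conv_rep S H : standing S -> findim Y -> linear_on S H ->
  minimal_FMP S H -> minimally_continuous H -> exists k, conv_rep S H k.
Proof.
move=> St fY lH mF mC; have [k [kd kt]] := linear_kernel St lH.
have kc t : continuous (k t).
  (* By linearity only 0 matters, and the unit ball, on which minimal continuity speaks, is a
     neighbourhood of 0. *)
  apply: continuousfor0_continuous.
  have /subspace_continuousP/(_ 0) := mC t; rewrite /= normr0 => /(_ ler01).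
  move=> /cvgrPdist_lt cH; apply/cvgrPdist_lt => e e0.
  have n1 : \forall x \near (0 : Z), `|x| <= 1.
    apply/nbhs_ballP; exists 1 => //= x.
    by rewrite -ball_normE/= sub0r normrN; exact: ltW.
  apply: filterS2 n1 (cH e e0) => x /= x1 /(_ x1).
  by rewrite /from_subspace !kd ?normr0.
have kcvg z : S z -> (fun N => \sum_(0 <= t < N.+1) k t (z t)) @ \oo --> H z.
  by move=> Sz; under eq_fun do rewrite -(kt z Sz); exact: mF.
exists k; split=> // z Sz; apply/nneseries_ltyP => //.
apply: findim_unconditional => // J.
have [_ _ _ /(_ z Sz J) SJ] := St.
apply/cvg_ex; eexists; rewrite -cvg_shiftS; apply: cvg_trans (kcvg _ SJ).
apply: near_eq_cvg; apply: nearW => n; apply: eq_bigr => t _.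
by case: ifP; rewrite ?linear0.
Qed.

(** Isolates what depends on p and w: nonexpansive delta^t give minimal continuity, and norm
    convergence of truncations gives the minimal FMP. *)
Lemma cont_minimal S H p w : standing S ->
  (forall t (x y : Z),
     (wnorm p w (fun s => (delta t x s - delta t y s)%R) <= `|x - y|%:E)%E) ->
  (forall z, S z -> forall d : R, 0 < d -> exists N, forall n, (N <= n)%N ->
     (wnorm p w (fun t => (trunc n z t - z t)%R) < d%:E)%E) ->
  cont_wrt (wnorm p w) S H -> minimal_FMP S H /\ minimally_continuous H.
Proof.
move=> St wdelta wtrunc cH; split=> [z Sz|t].
  apply/cvgrPdist_lt => e e0; have [d d0 dP] := cH z Sz e e0.
  have [N NP] := wtrunc z Sz d d0; exists N => // n /= Nn.
  by rewrite distrC; apply: dP; [exact: trunc_in|exact: NP].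
have [_ _ Sd _] := St.
apply/subspace_continuousP => x /= x1; apply/cvgrPdist_lt => e e0.
have [d d0 dP] := cH _ (Sd t x x1) e e0.
have : \forall y \near x, `|y - x| < d.
  by apply/nbhs_ballP; exists d => //= y; rewrite -ball_normE/= distrC.
apply: filterS => y /= yx y1; rewrite distrC.
apply: dP; first exact: Sd.
by apply: le_lt_trans (wdelta t y x) _; rewrite lte_fin.
Qed.

Lemma dominated_cont S H k p w : conv_rep S H k ->
  dominated p w (fun t => opnorm (k t)) -> cont_wrt (wnorm p w) S H.
Proof.
move=> [[kc kH] _] dom z Sz e e0.
(* Passing to the limit yields only a non-strict bound, so half of e is used. *)
have [d d0 dP] := dom (e / 2) (divr_gt0 e0 (ltr0n _ 2)).
exists d => // x Sx xd.
have cv : (fun N => \sum_(0 <= t < N.+1) k t (x t - z t)) @ \oo --> H x - H z.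
  under eq_fun do (under eq_bigr do rewrite linearB; rewrite sumrB).
  by apply: cvgB; exact: kH.
have : `|H x - H z| <= e / 2.
  have {}cv := @cvg_norm _ _ _ _ eventually_filter _ _ cv.
  rewrite -(cvg_lim (@Rhausdorff R) cv).
  apply: limr_le; first by apply/cvg_ex; eexists; exact: cv.
  apply: nearW => n; apply: le_trans (ler_norm_sum _ _ _) _.
  apply: le_trans (dP (fun t => `|x t - z t|) _ (ltW xd) n.+1) => //.
  by apply: ler_sum => t _; exact: ler_opnorm.
by move=> /le_lt_trans; apply; rewrite ltr_pdivrMr// mulr_natr mulr2n ltrDl.
Qed.

(** With u_t in the unit ball nearly norming kappa_t, the sequence a_t u_t lies in c_0 and in the
    unit ball of l^p, hence in [S], where the representation converges absolutely. The factor 2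
    comes from [opnorm_half]. *)
Lemma kernel_dual S H k p : (0 <= p)%E -> c0 Z `&` Bp p `<=` S ->
  conv_rep S H k ->
  forall a, (forall t, 0 <= a t) -> a @ \oo --> (0 : R) ->
    (seqnorm p (fun=> 1%R) a <= 1)%E ->
    exists M : R, forall n, \sum_(0 <= t < n) a t * opnorm (k t) <= M.
Proof.
move=> p0 subS [[kc _] kabs] a a0 a_0 a1.
have /choice[u uP] t : exists u, `|u| <= 1 /\ opnorm (k t) / 2 <= `|k t u|.
  by have [u] := opnorm_half (kc t); exists u.
pose z t := a t *: u t.
have za t : `|z t| <= a t.
  by rewrite normrZ ger0_norm// ler_piMr//; case: (uP t).
have /kabs/nneseries_ltyP[//|M MP] : S z.
  apply: subS; split.
    by apply: squeeze_cvgr (cvg_cst 0) a_0; apply: nearW => t; rewrite normr_ge0/=.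
  apply: le_trans a1; apply: seqnorm_mono => // t; first by rewrite ler01 lexx.
  by rewrite normr_ge0 za.
exists (2 * M) => n; apply: le_trans (ler_wpM2l _ (MP n)) => //.
rewrite mulr_sumr ler_sum// => t _; rewrite linearZ normrZ (ger0_norm (a0 t)).
rewrite mulrCA ler_wpM2l// -ler_pdivrMl// mulrC; by case: (uP t).
Qed.

Lemma trunc_subE n z t : `|trunc n z t - z t| = if (n < t)%N then `|z t| else 0.
Proof.
by rewrite /trunc ltnNge; case: ifP => _ /=; rewrite ?subrr ?normr0// sub0r normrN.
Qed.

(** The truncation error is a weighted tail, dominated by the tail of the sum of |z_t|^r since w <=
    1. *)
Lemma lp_trunc r w z : 0 < r -> (forall t, 0 <= w t <= 1) -> lp r%:E z ->
  forall d : R, 0 < d -> exists N, forall n, (N <= n)%N ->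
  (wnorm r%:E w (fun t => (trunc n z t - z t)%R) < d%:E)%E.
Proof.
move=> r0 w01 /seqnorm_lty_sumP[]// M MP d d0.
have d2 : 0 < d / 2 by rewrite divr_gt0.
have {}MP n : \sum_(0 <= t < n) `|z t| `^ r <= M.
  by have := MP n; under eq_bigr do rewrite mul1r.
have [N NP] := bounded_sum_tail (fun t => powR_ge0 `|z t| r) MP (powR_gt0 r d2).
exists N => n Nn; apply: (@le_lt_trans _ _ (d / 2)%:E); last first.
  by rewrite lte_fin ltr_pdivrMr// mulr_natr mulr2n ltrDl.
apply/seqnorm_leP => // [|t|m]; [exact: ltW|by have /andP[] := w01 t|].
have z0 t : (t <= n)%N -> w t * `|trunc n z t - z t| `^ r = 0.
  by move=> tn; rewrite trunc_subE ltnNge tn/= powR0 ?mulr0// gt_eqF.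
have [mN|/ltnW Nm] := leqP m N.
  rewrite big_nat big1 ?powR_ge0// => t /andP[_ tm].
  by rewrite z0// (leq_trans (ltnW tm))// (leq_trans mN).
rewrite (big_cat_nat (leq0n N) Nm)/= big_nat big1 ?add0r; last first.
  by move=> t /andP[_ tN]; rewrite z0// (leq_trans (ltnW tN)).
apply: le_trans (NP m); apply: ler_sum => t _.
have /andP[wt0 wt1] := w01 t; rewrite trunc_subE; case: ifP => _.
  by rewrite ler_piMl ?powR_ge0.
by rewrite powR0 ?mulr0 ?powR_ge0// gt_eqF.
Qed.

(** The sup norm of a tail is small only if w_t |z_t| vanishes at infinity; a null weight or a null
    z supplies this. *)
Lemma oo_trunc w z : (fun t => w t * `|z t|) @ \oo --> (0 : R) ->
  forall d : R, 0 < d -> exists N, forall n, (N <= n)%N ->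
  (wnorm +oo w (fun t => (trunc n z t - z t)%R) < d%:E)%E.
Proof.
move=> wz d d0; have d2 : 0 < d / 2 by rewrite divr_gt0.
have /cvgr0Pnorm_le/(_ _ d2)[N _ NP] := wz.
exists N => n Nn; apply: (@le_lt_trans _ _ (d / 2)%:E); last first.
  by rewrite lte_fin ltr_pdivrMr// mulr_natr mulr2n ltrDl.
apply/seqnorm_le_ooP => t; rewrite trunc_subE.
case: ifPn => [nt|_]; last by rewrite mulr0 ltW.
by apply: le_trans (ler_norm _) _; apply: NP => /=; rewrite (leq_trans Nn)// ltnW.
Qed.

End Functionals.

(** * Representation with norm control *)

Section Representation.
Context {R : realType} {Z Y : normedModType R}.
Implicit Types (S : set (nat -> Z)) (H : (nat -> Z) -> Y) (z : nat -> Z).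
Implicit Types (k : nat -> {linear Z -> Y}) (p : \bar R) (w : nat -> R) (r : R).

Lemma weighting_unit w : weighting w -> forall t, 0 <= w t <= 1.
Proof. by move=> [_ w01 _] t; have /andP[/ltW -> ->] := w01 t. Qed.

Lemma delta_subE t (x y : Z) s :
  `|delta t x s - delta t y s| = if s == t then `|x - y| else 0.
Proof. by rewrite /delta; case: ifP => _; rewrite ?subrr ?normr0. Qed.

Lemma cont_wrt_pnorm S H p w : (0 <= p)%E -> (forall t, 0 <= w t <= 1) ->
  cont_wrt (wnorm p w) S H -> cont_wrt (pnorm p) S H.
Proof.
move=> p0 w01 cH z Sz e e0; have [d d0 dP] := cH z Sz e e0.
exists d => // x Sx xd; apply: dP => //; apply: le_lt_trans xd.
by apply: seqnorm_mono => // t; rewrite normr_ge0 lexx.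
Qed.

Lemma lp_cont_minimal S H r w : 0 < r -> (forall t, 0 <= w t <= 1) ->
  standing S -> S `<=` lp r%:E -> cont_wrt (wnorm r%:E w) S H ->
  minimal_FMP S H /\ minimally_continuous H.
Proof.
move=> r0 w01 St Slp; apply: cont_minimal => // [t x y|z /Slp]; last exact: lp_trunc.
apply: (@seqnorm_single_le _ _ _ _ t) => // [s|s st|].
- by have /andP[] := w01 s.
- by rewrite delta_subE (negbTE st).
- by rewrite delta_subE eqxx ler_piMl ?powR_ge0//; have /andP[] := w01 t.
Qed.

Lemma oo_cont_minimal S H w : (forall t, 0 <= w t <= 1) -> standing S ->
  (forall z, S z -> (fun t => w t * `|z t|) @ \oo --> (0 : R)) ->
  cont_wrt (wnorm +oo%E w) S H -> minimal_FMP S H /\ minimally_continuous H.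
Proof.
move=> w01 St Sw; apply: cont_minimal => // [t x y|z /Sw]; last exact: oo_trunc.
apply: (@seqnorm_oo_single_le _ _ _ t) => // [s st|].
- by rewrite delta_subE (negbTE st).
- by rewrite delta_subE eqxx ler_piMl//; have /andP[] := w01 t.
Qed.

Lemma weighted_loo_cvg0 w z : weighting w -> lp +oo%E z ->
  (fun t => w t * `|z t|) @ \oo --> (0 : R).
Proof.
move=> ww; have w01 := weighting_unit ww; have [_ _ w_0] := ww.
move=> /seqnorm_ltyP[]// M M0 /seqnorm_le_ooP zM.
have wM : (fun t => w t * M) @ \oo --> (0 : R).
  by rewrite -(mul0r M); apply: cvgMr_tmp.
apply: squeeze_cvgr (cvg_cst 0) wM; apply: nearW => t.
have /andP[wt0 _] := w01 t.
by rewrite mulr_ge0//= ler_wpM2l//; have := zM t; rewrite mul1r.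
Qed.

(** Summability of a^r forces a -> 0, so the test sequence meets the c_0 condition by itself. *)
Lemma kernel_dual_powR S H k r : 0 < r -> c0 Z `&` Bp r%:E `<=` S ->
  conv_rep S H k ->
  forall a, (forall t, 0 <= a t) ->
    (forall n, \sum_(0 <= t < n) a t `^ r <= 1) ->
    exists M : R, forall n, \sum_(0 <= t < n) a t * opnorm (k t) <= M.
Proof.
move=> r0 subS kH a a0 a1; apply: (kernel_dual _ subS kH a0).
- by rewrite lee_fin ltW.
- have ar0 t : 0 <= a t `^ r by exact: powR_ge0.
  have ri : 0 < r^-1 by rewrite invr_gt0.
  have := cvg0_powR ri ar0 (bounded_sum_cvg0 ar0 a1).
  by under eq_fun do rewrite -powRrM mulfV ?gt_eqF// powRr1//.
- apply/seqnorm_leP => // n; rewrite powR1.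
  by under eq_bigr do rewrite mul1r.
Qed.

Lemma kernel_loo S H k : c0 Z `&` Bp 1%E `<=` S -> conv_rep S H k ->
  (kappanorm +oo%E k < +oo)%E.
Proof.
move=> subS kH; have [[kc _] _] := kH.
have [M MP] := dual_l1 (fun t => opnorm_ge0 (kc t))
  (kernel_dual_powR ltr01 subS kH).
apply: (@le_lt_trans _ _ M%:E); last exact: ltry.
by apply/seqnorm_le_ooP => t; rewrite mul1r.
Qed.

Lemma kernel_lq S H k (p q : R) : 1 < p -> 1 < q -> p^-1 + q^-1 = 1 ->
  c0 Z `&` Bp p%:E `<=` S -> conv_rep S H k -> (kappanorm q%:E k < +oo)%E.
Proof.
move=> p1 q1 pq subS kH; have [[kc _] _] := kH.
have [M MP] := dual_lq p1 q1 pq (fun t => opnorm_ge0 (kc t))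
  (kernel_dual_powR (lt_trans ltr01 p1) subS kH).
apply/seqnorm_lty_sumP => [|//|t|]; [exact: lt_trans q1|exact: opnorm_ge0|].
by exists M => n; under eq_bigr do rewrite mul1r.
Qed.

Lemma kernel_l1 S H k : c0 Z `&` Bp +oo%E `<=` S -> conv_rep S H k ->
  (kappanorm 1%E k < +oo)%E.
Proof.
move=> subS kH; have [[kc _] _] := kH.
have [|M MP] := dual_c0 (fun t => opnorm_ge0 (kc t)).
  move=> a a01 a_0; apply: (kernel_dual _ subS kH) => // [t|].
    by have /andP[] := a01 t.
  by apply/seqnorm_le_ooP => t; rewrite mul1r; have /andP[] := a01 t.
apply/seqnorm_lty_sumP => // [t|]; first exact: opnorm_ge0.
exists M => n; under eq_bigr do rewrite mul1r powRr1 ?opnorm_ge0//; exact: MP.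
Qed.

(** For |x| <= 1 the sequence delta^t x is within w_t of the zero sequence, so continuity at that
    one point controls kappa_t on the whole unit ball as soon as w_t is small. *)
Lemma weighted1_opnorm_cvg0 S H k w : standing S -> weighting w ->
  cont_wrt (wnorm 1%E w) S H -> conv_rep S H k ->
  (fun t => opnorm (k t)) @ \oo --> (0 : R).
Proof.
move=> St [_ w01 w_0] cH kH; have [[kc _] _] := kH; have [_ _ Sd _] := St.
have z1 : `|0 : Z| <= 1 by rewrite normr0.
(* The zero sequence is written as delta^0 applied to 0, which shows that it is in [S]. *)
apply/cvgr0Pnorm_le => e e0; have [d d0 dP] := cH _ (Sd 0%N 0 z1) e e0.
have /cvgr0Pnorm_lt/(_ d d0) := w_0; apply: filterS => t wd.
rewrite ger0_norm ?opnorm_ge0//; apply: opnorm_le => x x1.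
have /andP[wt0 _] := w01 t.
have := dP _ (Sd t x x1); rewrite !(conv_rep_delta _ St kH)// linear0 subr0.
move=> h; apply/ltW/h; apply: (@le_lt_trans _ _ (w t)%:E); last first.
  by rewrite lte_fin; apply: le_lt_trans wd; exact: ler_norm.
have dE s : `|delta t x s - delta 0 (0 : Z) s| = if s == t then `|x| else 0.
  by rewrite /delta if_same subr0; case: ifP; rewrite ?normr0.
apply: (@seqnorm_single_le _ _ _ _ t) => // [|s|s st|]; first exact: ltW.
- by have /andP[/ltW] := w01 s.
- by rewrite dE (negbTE st).
- by rewrite dE eqxx !powRr1 ?ler_piMr// ltW.
Qed.

Lemma kernel_l1_weighted S H k : S `<=` lp +oo%E -> conv_rep S H k ->
  (kappanorm 1%E k < +oo)%E -> p_weighted_FMP +oo%E S H.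
Proof.
move=> Slp kH; have [[kc _] _] := kH.
move=> /seqnorm_lty_sumP[//|//|t|M MP]; first exact: opnorm_ge0.
have {}MP n : \sum_(0 <= t < n) opnorm (k t) <= M.
  have := MP n; under eq_bigr do rewrite mul1r powRr1 ?opnorm_ge0//; exact.
have [v vw [K K0 KP]] := summable_weight (fun t => opnorm_ge0 (kc t)) MP.
split=> //; exists v; split=> //; apply: dominated_cont kH _.
apply: (dominated_oo K0) => // t; last exact: opnorm_ge0.
by have [_ v01 _] := vw; have /andP[] := v01 t.
Qed.

Lemma kernel_lq_weighted S H k (p q : R) : 1 < p -> 1 < q -> p^-1 + q^-1 = 1 ->
  S `<=` lp p%:E -> conv_rep S H k ->
  (kappanorm q%:E k < +oo)%E -> p_weighted_FMP p%:E S H.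
Proof.
move=> p1 q1 pq Slp kH; have [[kc _] _] := kH.
have p0 : 0 < p by exact: lt_trans p1.
have q0 : 0 < q by exact: lt_trans q1.
move=> /(seqnorm_lty_sumP q0)[//|t|M MP]; first exact: opnorm_ge0.
have {}MP n : \sum_(0 <= t < n) opnorm (k t) `^ q <= M.
  by have := MP n; under eq_bigr do rewrite mul1r.
have [v vw [K K0 KP]] :=
  summable_weight (fun t => powR_ge0 (opnorm (k t)) q) MP.
(* Splitting b x as (b v^(-1/q)) (v^(1/q) x) leaves v^(p/q) x^p in the p-th power of the second
   factor. *)
split=> //; exists (fun t => v t `^ (p / q)); split.
  by apply: weighting_powR => //; rewrite divr_gt0.
apply: dominated_cont kH _; apply: (dominated_powR p1 q1 pq _ _ K0) => // t.
  by have [_ v01 _] := vw; have /andP[] := v01 t.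
exact: opnorm_ge0.
Qed.

Lemma kernel_loo_continuous S H k : S `<=` lp 1%E -> conv_rep S H k ->
  (kappanorm +oo%E k < +oo)%E -> p_continuous 1%E S H.
Proof.
move=> Slp kH; have [[kc _] _] := kH.
move=> /seqnorm_ltyP[//|//|t|M M0 /seqnorm_le_ooP MP]; first exact: opnorm_ge0.
split=> //; apply: dominated_cont kH _; apply: (dominated1 M0) => // t.
by have := MP t; rewrite mul1r mulr1.
Qed.

Lemma kernel_c0_weighted S H k : S `<=` lp 1%E -> conv_rep S H k ->
  (fun t => opnorm (k t)) @ \oo --> (0 : R) -> p_weighted_FMP 1%E S H.
Proof.
move=> Slp kH k_0; have [[kc _] _] := kH.
have [v vw [K K0 KP]] := vanishing_weight (fun t => opnorm_ge0 (kc t)) k_0.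
split=> //; exists v; split=> //; apply: dominated_cont kH _.
apply: (dominated1 K0) => // t; by have /andP[] := weighting_unit vw t.
Qed.

End Representation.

(** * The equivalences for p = 1, 1 < p < oo and p = oo *)

Theorem theorem3p10 (R : realType) (Z Y : normedModType R)
  (S : set (nat -> Z)) (H : (nat -> Z) -> Y) :
  standing S -> findim Y -> linear_on S H ->
  (* (i) p = 1 *)
  (c0 Z `&` Bp 1%E `<=` S -> S `<=` lp 1%E ->
     (p_weighted_FMP 1%E S H <->
        exists k : nat -> {linear Z -> Y},
          conv_rep S H k /\ (fun t => opnorm (k t)) @ \oo --> (0 : R)) /\
     (p_continuous 1%E S H <->
        exists k : nat -> {linear Z -> Y},
          conv_rep S H k /\ (kappanorm +oo%E k < +oo)%E) /\
     ((exists k : nat -> {linear Z -> Y},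
          conv_rep S H k /\ (kappanorm +oo%E k < +oo)%E) <->
        minimal_FMP S H /\ minimally_continuous H)) /\
  (* (ii) 1 < p < oo, q Hoelder conjugate *)
  (forall p q : R, 1 < p -> 1 < q -> p^-1 + q^-1 = 1 ->
     c0 Z `&` Bp p%:E `<=` S -> S `<=` lp p%:E ->
     (p_weighted_FMP p%:E S H <-> p_continuous p%:E S H) /\
     (p_continuous p%:E S H <->
        exists k : nat -> {linear Z -> Y},
          conv_rep S H k /\ (kappanorm q%:E k < +oo)%E) /\
     ((exists k : nat -> {linear Z -> Y},
          conv_rep S H k /\ (kappanorm q%:E k < +oo)%E) <->
        minimal_FMP S H /\ minimally_continuous H)) /\
  (* (iii) p = oo *)
  (c0 Z `&` Bp +oo%E `<=` S -> S `<=` lp +oo%E ->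
     (p_weighted_FMP +oo%E S H <->
        exists k : nat -> {linear Z -> Y},
          conv_rep S H k /\ (kappanorm 1%E k < +oo)%E) /\
     ((exists k : nat -> {linear Z -> Y},
          conv_rep S H k /\ (kappanorm 1%E k < +oo)%E) <->
        minimal_FMP S H /\ minimally_continuous H) /\
     (S `<=` c0 Z ->
        (p_weighted_FMP +oo%E S H <-> p_continuous +oo%E S H))).
Proof.
move=> St fY lH.
have repr : minimal_FMP S H /\ minimally_continuous H ->
    exists k : nat -> {linear Z -> Y}, conv_rep S H k.
  by move=> [mF mC]; exact: minimal_conv_rep.
(* The unweighted norm has constant weight 1, so lemmas asking only for weights in [0,1] cover
   p-continuity too. *)
have unit1 (t : nat) : 0 <= (1 : R) <= 1 by rewrite ler01 lexx.
split; [|split].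
- move=> subS Slp; have l01 : 0 < (1 : R) by [].
  have bounded_repr : minimal_FMP S H /\ minimally_continuous H ->
      exists k : nat -> {linear Z -> Y},
        conv_rep S H k /\ (kappanorm +oo%E k < +oo)%E.
    by move=> /repr[k kH]; exists k; split=> //; exact: kernel_loo kH.
  split; [split|split; split].
  + move=> [_ [w [ww cH]]]; have w01 := weighting_unit ww.
    have [k kH] := repr (lp_cont_minimal l01 w01 St Slp cH).
    by exists k; split=> //; exact: weighted1_opnorm_cvg0 cH kH.
  + by move=> [k [kH k_0]]; exact: kernel_c0_weighted kH k_0.
  + by move=> [_ cH]; apply: bounded_repr; exact: lp_cont_minimal cH.
  + by move=> [k [kH kb]]; exact: kernel_loo_continuous kH kb.
  + by move=> [k [kH _]]; exact: conv_rep_minimal kH.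
  + exact: bounded_repr.
- move=> p q p1 q1 pq subS Slp; have p0 : 0 < p by exact: lt_trans p1.
  have minimal_repr : minimal_FMP S H /\ minimally_continuous H ->
      exists k : nat -> {linear Z -> Y},
        conv_rep S H k /\ (kappanorm q%:E k < +oo)%E.
    by move=> /repr[k kH]; exists k; split=> //; exact: (kernel_lq p1 q1 pq subS kH).
  have cont_repr (cH : p_continuous p%:E S H) :
      exists k : nat -> {linear Z -> Y},
        conv_rep S H k /\ (kappanorm q%:E k < +oo)%E.
    by case: cH => _ cH; apply: minimal_repr; exact: lp_cont_minimal cH.
  have weighted_cont : p_weighted_FMP p%:E S H -> p_continuous p%:E S H.
    move=> [_ [w [ww cH]]]; split=> //.
    by apply: cont_wrt_pnorm cH; [rewrite lee_fin ltW|exact: weighting_unit].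
  have repr_weighted : (exists k : nat -> {linear Z -> Y},
      conv_rep S H k /\ (kappanorm q%:E k < +oo)%E) -> p_weighted_FMP p%:E S H.
    by move=> [k [kH kq]]; exact: (kernel_lq_weighted p1 q1 pq Slp kH kq).
  split; [split|split; split] => //.
  + by move=> /cont_repr.
  + by move=> /repr_weighted.
  + by move=> [k [kH _]]; exact: conv_rep_minimal kH.
- move=> subS Slp.
  have minimal_repr : minimal_FMP S H /\ minimally_continuous H ->
      exists k : nat -> {linear Z -> Y},
        conv_rep S H k /\ (kappanorm 1%E k < +oo)%E.
    by move=> /repr[k kH]; exists k; split=> //; exact: kernel_l1 kH.
  have repr_weighted : (exists k : nat -> {linear Z -> Y},
      conv_rep S H k /\ (kappanorm 1%E k < +oo)%E) -> p_weighted_FMP +oo%E S H.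
    by move=> [k [kH k1]]; exact: kernel_l1_weighted k1.
  split; [split|split; [split|move=> Sc0; split]] => //.
  + move=> [_ [w [ww cH]]]; apply: minimal_repr.
    apply: oo_cont_minimal cH => //; first exact: weighting_unit.
    by move=> z /Slp; exact: weighted_loo_cvg0.
  + by move=> [k [kH _]]; exact: conv_rep_minimal kH.
  + move=> [_ [w [ww cH]]]; split=> //.
    by apply: cont_wrt_pnorm cH => //; exact: weighting_unit.
  (* Elements of c_0 have truncations converging in the unweighted sup norm, so the minimal
     conditions follow and the kernel then provides a weight. *)
  + move=> [_ cH]; apply/repr_weighted/minimal_repr.
    apply: oo_cont_minimal cH => // z /Sc0.
    by under [in X in _ -> X]eq_fun do rewrite mul1r.
Qed.
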